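(* Let $\delta_{NN}>0$ and let $u_{\tilde\theta}\in U_{NN}$ be a quasi-minimizer, i.e. $$\|\phi(u_{\tilde\theta})\|_V\le\inf_{\theta\in\mathbb{R}^s}\|\phi(u_\theta)\|_V+\delta_{NN}.$$ Let $u\in U$ be the exact solution of $b(u,v)=l(v)$ for all $v\in V$. Let $u_{\theta^k}\in U_{NN}$ be the neural network obtained at the $k$th iteration ($k\ge1$) of the sequential adaptive algorithm (described in the context) with parameters $\epsilon_0>0$ and $0<\delta<1$, and assume $\eta_k(u_{\theta^k})\le\eta_k(u_{\theta^{k-1}})$, where $\eta_k(w):=\|\phi(w)-\phi_k(w)\|_V$. Then $$\|u_{\tilde\theta}-u_{\theta^k}\|_U\le\frac{1}{\alpha}\left(\mu\inf_{\theta\in\mathbb{R}^s}\|u-u_\theta\|_U+\delta_{NN}+2\delta^k\epsilon_0\right),$$ where $\mu$ and $\alpha$ are the boundedness and inf-sup constants of $b$.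
   Context: Setting: $U$ and $V$ are (real) Hilbert spaces with norms $\|\cdot\|_U$, $\|\cdot\|_V$; $(\cdot,\cdot)_V$ is the inner product inducing $\|\cdot\|_V$. $b:U\times V\to\mathbb{R}$ is a bilinear form and $l\in V'$ a bounded linear functional such that: (1) (boundedness) there is $\mu>0$ with $b(w,v)\le\mu\|w\|_U\|v\|_V$ for all $w\in U$, $v\in V$; (2) (inf-sup) there is $\alpha>0$ with $\sup_{0\ne v\in V}\frac{b(w,v)}{\|v\|_V}\ge\alpha\|w\|_U$ for all $w\in U$; (3) if $v\in V$ satisfies $b(w,v)=0$ for all $w\in U$, then $v=0$. Under these assumptions the problem ''find $u\in U$ with $b(u,v)=l(v)$ for all $v\in V$'' has a unique solution. For $w\in U$ the residual is $r(w,\cdot):=l(\cdot)-b(w,\cdot)\in V'$. The (continuous) Riesz representative $\phi(w)\in V$ is defined by $(\phi(w),v)_V=r(w,v)$ for all $v\in V$. $U_{NN}=\{u_\theta:\theta\in\mathbb{R}^s\}\subset U$ is the set of functions representable by a fixed neural network architecture with parameter vector $\theta$; only $U_{NN}\subset U$ is assumed (it need not be linear, closed or convex). With each mesh $\mathcal{T}_k$ is associated a finite-dimensional test space $V_k\subset V$. The discrete Riesz representative $\phi_k(w)\in V_k$ is defined by $(\phi_k(w),v_k)_V=r(w,v_k)$ for all $v_k\in V_k$. The loss function is $\mathcal{L}_k(w):=\|\phi_k(w)\|_V^2$ and the Riesz discrepancy is $\eta_k(w):=\|\phi(w)-\phi_k(w)\|_V$. Sequential adaptive algorithm: given an initial mesh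 $\mathcal{T}_0$, $\epsilon_0>0$, $0<\delta<1$ and an initial network $u_{\theta^0}\in U_{NN}$ with $\sqrt{\mathcal{L}_0(u_{\theta^0})}\le\epsilon_0$, for $k=1,2,\dots$ set $\epsilon_k:=\delta\,\epsilon_{k-1}$ and: (ADAPT) refine $\mathcal{T}_{k-1}$ to a mesh $\mathcal{T}_k$ such that $\eta_k(u_{\theta^{k-1}})\le\epsilon_k$; (LEARN) train $u_{\theta^{k-1}}$ on $\mathcal{T}_k$ by minimizing $\mathcal{L}_k$ to obtain $u_{\theta^k}\in U_{NN}$ such that $\sqrt{\mathcal{L}_k(u_{\theta^k})}\le\epsilon_k$. *)

(* Defs.v *)
From HB Require Import structures.
From mathcomp Require Import all_boot all_order all_algebra.
From mathcomp Require Import all_classical all_reals all_analysis.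

Set Implicit Arguments.
Unset Strict Implicit.
Unset Printing Implicit Defensive.

Import Order.TTheory GRing.Theory Num.Theory.
Import numFieldNormedType.Exports.

Local Open Scope classical_set_scope.
Local Open Scope ring_scope.

(* A real Hilbert space is a completeNormedModType together with an inner
   product for which this holds. *)
Definition induces_norm (R : realType) (V : normedModType R)
    (ip : {dot V for @idfun R}) : Prop :=
  forall v, `|v| = Num.sqrt (ip v v).

Definition bounded_functional (R : realType) (V : normedModType R)
    (l : {scalar V}) : Prop :=
  exists C : R, forall v, `|l v| <= C * `|v|.

Definition bounded_form (R : realType) (U V : normedModType R)
    (b : {bilinear U -> V -> R | *%R & *%R}) (mu : R) : Prop :=
  forall w v, b w v <= mu * `|w| * `|v|.

(* The supremum is the real-valued [sup], with [sup set0 = 0]: the set below is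
   empty only when V = 0, and is bounded above as soon as [b] is bounded. *)
Definition inf_sup_condition (R : realType) (U V : normedModType R)
    (b : {bilinear U -> V -> R | *%R & *%R}) (alpha : R) : Prop :=
  forall w, alpha * `|w| <= sup [set b w v / `|v| | v in [set v | v != 0]].

Definition right_nondegenerate (R : realType) (U V : normedModType R)
    (b : {bilinear U -> V -> R | *%R & *%R}) : Prop :=
  forall v, (forall w, b w v = 0) -> v = 0.

Definition weak_solution (R : realType) (U V : normedModType R)
    (b : {bilinear U -> V -> R | *%R & *%R}) (l : {scalar V}) (u : U) : Prop :=
  forall v, b u v = l v.

Definition finite_dim_subspace (R : realType) (V : normedModType R)
    (E : set V) : Prop :=
  exists (n : nat) (e : 'I_n -> V),
    E = range (fun c : 'I_n -> R => \sum_(i < n) c i *: e i).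

Definition residual (R : realType) (U V : normedModType R)
    (b : {bilinear U -> V -> R | *%R & *%R}) (l : {scalar V}) (w : U) (v : V)
  : R := l v - b w v.

(* The x in E with (x, v) = f v for all v in E. It exists and is unique when f
   is a bounded linear functional and E is a complete subspace; the default
   value 0 plays no role then. *)
Definition riesz_representative (R : realType) (V : normedModType R)
    (ip : {dot V for @idfun R}) (E : set V) (f : V -> R) : V :=
  xget 0 [set x | E x /\ forall v, E v -> ip x v = f v].

Definition phi (R : realType) (U V : normedModType R)
    (ip : {dot V for @idfun R}) (b : {bilinear U -> V -> R | *%R & *%R})
    (l : {scalar V}) (w : U) : V :=
  riesz_representative ip [set: V] (residual b l w).

Definition discrete_phi (R : realType) (U V : normedModType R)
    (ip : {dot V for @idfun R}) (b : {bilinear U -> V -> R | *%R & *%R})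
    (l : {scalar V}) (E : set V) (w : U) : V :=
  riesz_representative ip E (residual b l w).

Definition loss (R : realType) (U V : normedModType R)
    (ip : {dot V for @idfun R}) (b : {bilinear U -> V -> R | *%R & *%R})
    (l : {scalar V}) (E : set V) (w : U) : R :=
  `|discrete_phi ip b l E w| ^+ 2.

Definition riesz_discrepancy (R : realType) (U V : normedModType R)
    (ip : {dot V for @idfun R}) (b : {bilinear U -> V -> R | *%R & *%R})
    (l : {scalar V}) (E : set V) (w : U) : R :=
  `|phi ip b l w - discrete_phi ip b l E w|.

Fixpoint tolerance (R : realType) (eps0 delta : R) (k : nat) : R :=
  if k is j.+1 then delta * tolerance eps0 delta j else eps0.

(* The first k iterations of the algorithm produce the meshes T 0, ..., T k and
   the parameters theta 0, ..., theta k; the entries of the sequences beyond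
   index k are irrelevant. [refines M' M] means that M' is a refinement of M,
   and [testsp M] is the test space associated with the mesh M. *)
Definition adaptive_run (R : realType) (U V : normedModType R)
    (ip : {dot V for @idfun R}) (b : {bilinear U -> V -> R | *%R & *%R})
    (l : {scalar V}) (s : nat) (uNN : 'rV[R]_s -> U)
    (mesh : Type) (refines : mesh -> mesh -> Prop) (testsp : mesh -> set V)
    (eps0 delta : R) (k : nat) (T : nat -> mesh) (theta : nat -> 'rV[R]_s)
  : Prop :=
  Num.sqrt (loss ip b l (testsp (T 0)) (uNN (theta 0))) <= eps0 /\
  forall j, (j < k)%N ->
    [/\ refines (T j.+1) (T j),
        riesz_discrepancy ip b l (testsp (T j.+1)) (uNN (theta j))
          <= tolerance eps0 delta j.+1
      & Num.sqrt (loss ip b l (testsp (T j.+1)) (uNN (theta j.+1)))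
          <= tolerance eps0 delta j.+1].

(* Main.v *)
Require Import Defs.
From mathcomp Require Import all_boot all_order all_algebra.
From mathcomp Require Import all_classical all_reals all_analysis.
From mathcomp Require Import ring lra.
Import Order.TTheory GRing.Theory Num.Theory.
Import numFieldNormedType.Exports.
Local Open Scope classical_set_scope.
Local Open Scope ring_scope.

(** Since [(phi w, v) = l v - b w v], the difference [b (uq - uk) v] equals
    [(phi uk - phi uq, v)], so the inf-sup condition and Cauchy-Schwarz give
    [alpha |uq - uk| <= |phi uk| + |phi uq|]. The triangle inequality through
    the discrete Riesz representative bounds [|phi uk|] by discrepancy plus
    root loss, each at most [delta ^ k eps0]; quasi-minimality and
    [|phi w| <= mu |u - w|] bound [|phi uq|]. As [phi] is a chosen value, all
    this rests on the Riesz representation theorem, obtained by minimizing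
    [|v|^2 - 2 f v]. *)

Lemma dot_sym (R : realType) (V : lmodType R) (ip : {dot V for @idfun R})
  (a c : V) : ip a c = ip c a.
Proof. by rewrite hermC expr0 mul1r. Qed.

Lemma sqr_norm (R : realType) (V : normedModType R)
  (ip : {dot V for @idfun R}) (ip_norm : induces_norm ip) (v : V) :
  `|v| ^+ 2 = ip v v.
Proof.
rewrite ip_norm sqr_sqrtr//.
have [->|v_neq0] := eqVneq v 0; first by rewrite linear0r.
exact/ltW/neq0_dnorm_gt0.
Qed.

Lemma sqr_normDZ (R : realType) (V : normedModType R)
  (ip : {dot V for @idfun R}) (ip_norm : induces_norm ip) (a c : V) (t : R) :
  `|a + t *: c| ^+ 2 = `|a| ^+ 2 + 2 * t * ip a c + t ^+ 2 * `|c| ^+ 2.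
Proof.
have expand v : ip v (a + t *: c) = ip v a + t * ip v c.
  by rewrite linearDr linearZr.
rewrite !(sqr_norm _ _ _ ip_norm) expand dot_sym expand.
rewrite (dot_sym _ _ ip (a + _)) expand (dot_sym _ _ ip c a).
ring.
Qed.

(* The triangle inequality of the induced norm is already part of the
   [normedModType] structure; expanding its square gives Cauchy-Schwarz. *)
Lemma dot_le_norm (R : realType) (V : normedModType R)
  (ip : {dot V for @idfun R}) (ip_norm : induces_norm ip) (a c : V) :
  ip a c <= `|a| * `|c|.
Proof.
have := sqr_normDZ _ _ _ ip_norm a c 1; rewrite scale1r => e.
have : `|a + c| ^+ 2 <= (`|a| + `|c|) ^+ 2.
  by rewrite lerXn2r ?nnegrE ?addr_ge0// ler_normD.
rewrite e; nra.
Qed.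

(** Along a line, [J] is a quadratic polynomial whose linear coefficient is [2 * (ip a d - f d)], so
    near a minimizer this coefficient must be small. The limit [x] is never shown to minimize [J];
    near-minimizers [a] close to [x] suffice. *)
Lemma riesz_representation (R : realType) (V : completeNormedModType R)
  (ip : {dot V for @idfun R}) (ip_norm : induces_norm ip) (f : {scalar V}) :
  bounded_functional f -> exists x, forall v, ip x v = f v.
Proof.
move=> [C fC].
pose J v := `|v| ^+ 2 - 2 * f v.
have JD a d t :
    J (a + t *: d) = J a + 2 * t * (ip a d - f d) + t ^+ 2 * `|d| ^+ 2.
  have fD : f (a + t *: d) = f a + t * f d by rewrite linearD linearZ.
  by rewrite /J (sqr_normDZ _ _ _ ip_norm) fD; ring.
have J_inf : has_inf (range J).
  split; first by exists (J 0), 0.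
  (* Completing the square: [J v] is at least [(|v| - C)^2 - C^2]. *)
  exists (- C ^+ 2) => _ [v _ <-]; rewrite /J.
  have := le_trans (ler_norm _) (fC v).
  have := sqr_ge0 (`|v| - C); nra.
set m := inf (range J).
have mJ v : m <= J v by apply: ge_inf; [case: J_inf | exists v].
(* The sublevel sets of [J] are Cauchy by the parallelogram identity. *)
pose F := filter_from [set e : R | 0 < e] (fun e => [set v | J v < m + e]).
have FF : ProperFilter F.
  apply: filter_from_proper.
    apply: filter_from_filter; first by exists 1; rewrite /= ltr01.
    move=> e1 e2 /= e1_gt0 e2_gt0; exists (Num.min e1 e2).
      by rewrite /= lt_min e1_gt0.
    by move=> v /=; rewrite -ltrBlDl lt_min => /andP[]; rewrite !ltrBlDl.
  by move=> e /= /inf_adherent/(_ J_inf)[_ [v _ <-]]; exists v.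
have /cauchy_cvgP : cauchy F.
  apply: cauchy_exP => eps eps_gt0.
  have e_gt0 : 0 < eps ^+ 2 / 4 by rewrite divr_gt0// exprn_gt0.
  have [_ [a _ <-] /= Ja] := inf_adherent e_gt0 J_inf.
  exists a; exists (eps ^+ 2 / 4) => //= c /= Jc.
  rewrite -ball_normE /ball_ /= distrC.
  (* At the midpoint, [|c - a|^2 / 4] is the mean of [J a] and [J c] minus the value of [J] there,
     hence below [eps^2 / 4]. *)
  have := mJ (a + 2^-1 *: (c - a)).
  have := JD a (c - a) 1; rewrite scale1r [a + (c - a)]addrC subrK => Jce.
  rewrite JD => mid.
  rewrite -(@ltr_pXn2r _ 2)// ?nnegrE ?(ltW eps_gt0)//.
  rewrite -/m in Ja; lra.
move=> /cvg_ex[x Fx]; exists x => v.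
apply/eqP; rewrite -subr_eq0; apply/negPn/negP; rewrite -normr_gt0.
set D := `|_| => D_gt0.
set q := `|v| ^+ 2.
have q_ge0 : 0 <= q by rewrite exprn_ge0.
have v1_gt0 : 0 < 1 + `|v| by rewrite ltr_pwDl.
have q1_gt0 : 0 < 1 + q by rewrite ltr_pwDl.
(* The radius makes replacing [x] by [a] cost at most half of the defect [D]; the tolerance below is
   the decrease of [J] that a defect [D / 2] forces. Adding 1 keeps the denominators positive
   without treating [v = 0] apart. *)
have r_gt0 : 0 < D / (2 * (1 + `|v|)) by rewrite divr_gt0// mulr_gt0.
have e_gt0 : 0 < D ^+ 2 / (4 * (1 + q)).
  by rewrite divr_gt0 ?exprn_gt0// mulr_gt0.
have FJ : F [set a | J a < m + D ^+ 2 / (4 * (1 + q))].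
  by eexists; first exact: e_gt0.
have [a [/= Ja xa]] := filter_ex (filterI FJ (Fx _ (nbhsx_ballx x _ r_gt0))).
rewrite -ball_normE /ball_ /= in xa.
have xav : `|x - a| * `|v| <= D / 2.
  apply: (le_trans (ler_wpM2r _ (ltW xa))) => //.
  rewrite invfM mulrA -(mulrA (D / 2)).
  rewrite ler_piMr ?divr_ge0 ?(ltW D_gt0)//.
  by rewrite mulrC ler_pdivrMr// mul1r lerDr.
have g_ge : D / 2 <= `|ip a v - f v|.
  have ip_xa : `|ip x v - ip a v| <= D / 2.
    have ipB : ip (x - a) v = ip x v - ip a v by rewrite linearBl.
    rewrite -ipB ler_norml; apply/andP; split; last first.
      exact: le_trans (dot_le_norm _ _ _ ip_norm _ _) xav.
    rewrite lerNl; apply: le_trans xav.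
    have -> : - ip (x - a) v = ip (a - x) v by rewrite ipB linearBl opprB.
    by rewrite (distrC x); exact: dot_le_norm.
  have := ler_distD (ip a v) (ip x v) (f v); rewrite -/D; lra.
(* Moving from [a] along [v] by [- g / (1 + q)] would push [J] below
   its infimum. *)
set g := ip a v - f v in g_ge.
have := mJ (a + (- (g / (1 + q))) *: v); rewrite JD -/g -/q.
have gq : 2 * - (g / (1 + q)) * g + (- (g / (1 + q))) ^+ 2 * q
    <= - (g ^+ 2 / (1 + q)).
  have -> : 2 * - (g / (1 + q)) * g + (- (g / (1 + q))) ^+ 2 * q
      = - (g ^+ 2 / (1 + q)) - (g / (1 + q)) ^+ 2.
    by field; rewrite gt_eqF.
  by rewrite gerBl sqr_ge0.
have : D ^+ 2 / (4 * (1 + q)) <= g ^+ 2 / (1 + q).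
  rewrite invfM mulrA ler_pM2r ?invr_gt0//.
  rewrite -(real_normK (num_real g)); nra.
lra.
Qed.

Lemma phiP (R : realType) (U : normedModType R) (V : completeNormedModType R)
  (ip : {dot V for @idfun R}) (ip_norm : induces_norm ip)
  (b : {bilinear U -> V -> R | *%R & *%R}) (l : {scalar V}) (mu : R)
  (l_bounded : bounded_functional l) (b_bounded : bounded_form b mu) (w : U)
  (v : V) : ip (phi ip b l w) v = l v - b w v.
Proof.
have [C lC] := l_bounded.
have r_bounded : bounded_functional (l \- b w).
  exists (C + mu * `|w|) => z.
  (* The bound on [b] is one-sided; applying it to [- z] as well bounds the absolute value. *)
  have bN : b w (- z) = - b w z by rewrite linearNr.
  have := b_bounded w (- z); rewrite bN normrN => bz1.
  have bz2 := b_bounded w z.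
  have /= := lC z; rewrite !ler_norml => /andP[lz1 lz2].
  by rewrite mulrDl; apply/andP; split; lra.
have [x xP] := riesz_representation _ _ _ ip_norm _ r_bounded.
rewrite /phi /riesz_representative; case: xgetP => [y -> [_]|/(_ x) nx].
  exact.
by case: nx; split=> // z _; exact: xP.
Qed.

Lemma toleranceE (R : realType) (eps0 delta : R) (k : nat) :
  tolerance eps0 delta k = delta ^+ k * eps0.
Proof. by elim: k => [|k IH] /=; rewrite ?mul1r// IH exprS mulrA. Qed.

Lemma inf_sup_le (R : realType) (U V : normedModType R)
  (b : {bilinear U -> V -> R | *%R & *%R}) (alpha : R)
  (b_inf_sup : inf_sup_condition b alpha) (w : U) (K : R) (K_ge0 : 0 <= K)
  (bK : forall v, b w v <= K * `|v|) : alpha * `|w| <= K.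
Proof.
apply: le_trans (b_inf_sup w) _.
set S := (X in sup X).
(* If [V] is trivial the supremum is 0, and [K_ge0] concludes. *)
have [->|/set0P S_neq0] := eqVneq S set0; first by rewrite sup0.
apply: ge_sup => // _ [v /= v_neq0 <-].
by rewrite ler_pdivrMr ?normr_gt0.
Qed.

(** Testing the residual, which equals [b (u - w)], with [phi w] itself gives its squared norm; one
    factor then cancels. *)
Lemma norm_phi_le (R : realType) (U : normedModType R)
  (V : completeNormedModType R)
  (ip : {dot V for @idfun R}) (ip_norm : induces_norm ip)
  (b : {bilinear U -> V -> R | *%R & *%R}) (l : {scalar V}) (mu : R)
  (mu_gt0 : 0 < mu)
  (l_bounded : bounded_functional l) (b_bounded : bounded_form b mu) (u : U)
  (u_sol : weak_solution b l u) (w : U) : `|phi ip b l w| <= mu * `|u - w|.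
Proof.
have := phiP _ _ _ _ ip_norm b _ _ l_bounded b_bounded w (phi ip b l w).
set p := phi _ _ _ _.
have bB : b (u - w) p = b u p - b w p by rewrite linearBl.
rewrite -u_sol -bB => pp.
have [->|p_neq0] := eqVneq p 0; first by rewrite normr0 mulr_ge0// ltW.
have p_gt0 : 0 < `|p| by rewrite normr_gt0.
rewrite -(ler_pM2r p_gt0) -expr2 (sqr_norm _ _ _ ip_norm) pp.
exact: b_bounded.
Qed.

Theorem theorem5p4 (R : realType) (U V : completeNormedModType R)
  (ipU : {dot U for @idfun R}) (ipV : {dot V for @idfun R})
  (ipU_norm : induces_norm ipU) (ipV_norm : induces_norm ipV)
  (b : {bilinear U -> V -> R | *%R & *%R}) (l : {scalar V})
  (l_bounded : bounded_functional l)
  (mu : R) (mu_gt0 : 0 < mu) (b_bounded : bounded_form b mu)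
  (alpha : R) (alpha_gt0 : 0 < alpha) (b_inf_sup : inf_sup_condition b alpha)
  (b_nondeg : right_nondegenerate b)
  (s : nat) (uNN : 'rV[R]_s -> U)
  (mesh : Type) (refines : mesh -> mesh -> Prop) (testsp : mesh -> set V)
  (testsp_fin : forall M, finite_dim_subspace (testsp M))
  (deltaNN : R) (deltaNN_gt0 : 0 < deltaNN) (theta_q : 'rV[R]_s)
  (quasi_min : `|phi ipV b l (uNN theta_q)|
     <= inf (range (fun theta => `|phi ipV b l (uNN theta)|)) + deltaNN)
  (u : U) (u_sol : weak_solution b l u)
  (eps0 : R) (eps0_gt0 : 0 < eps0)
  (delta : R) (delta_gt0 : 0 < delta) (delta_lt1 : delta < 1)
  (k : nat) (k_ge1 : (1 <= k)%N)
  (T : nat -> mesh) (theta : nat -> 'rV[R]_s)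
  (run : adaptive_run ipV b l uNN refines testsp eps0 delta k T theta)
  (discrepancy_le :
     riesz_discrepancy ipV b l (testsp (T k)) (uNN (theta k))
     <= riesz_discrepancy ipV b l (testsp (T k)) (uNN (theta k.-1))) :
  `|uNN theta_q - uNN (theta k)|
  <= alpha^-1 * (mu * inf (range (fun theta => `|u - uNN theta|))
                 + deltaNN + 2 * delta ^+ k * eps0).
Proof.
have phiE := phiP _ _ _ _ ipV_norm b _ _ l_bounded b_bounded.
set r := phi ipV b l in phiE.
set uq := uNN theta_q; set uk := uNN (theta k).
have inf_phi_le : inf (range (fun theta => `|r (uNN theta)|))
    <= mu * inf (range (fun theta => `|u - uNN theta|)).
  (* Dividing by [mu] leaves a lower bound to check for each network separately. *)
  rewrite -ler_pdivrMl//; apply: lb_le_inf; first by exists `|u - uq|, theta_q.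
  move=> _ [t _ <-]; rewrite ler_pdivrMl//.
  apply: le_trans (norm_phi_le _ _ _ _ ipV_norm _ _ _ mu_gt0 l_bounded b_bounded
    _ u_sol _).
  by apply: ge_inf; [exists 0 => _ [t' _ <-] | exists t].
have rk_le : `|r uk| <= 2 * delta ^+ k * eps0.
  (* With [k = j.+1], [k.-1] reduces to [j], the index at which the run bounds the discrepancy on
     the new mesh. *)
  case: k k_ge1 run discrepancy_le @uk => // j _.
  move=> [_ /(_ j (ltnSn j))[_ eta_le loss_le]] /= disc_le.
  rewrite toleranceE in eta_le loss_le.
  rewrite /loss sqrtr_sqr normr_id in loss_le.
  set w := uNN (theta j.+1) in disc_le loss_le *.
  set pk := discrete_phi ipV b l _ _ in loss_le.
  have := ler_normD (r w - pk) pk; rewrite subrK.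
  have := le_trans disc_le eta_le; rewrite /riesz_discrepancy -/r -/pk; lra.
rewrite ler_pdivlMl//; apply: (inf_sup_le _ _ _ _ _ b_inf_sup).
  (* The bound dominates [|r uk| + |r uq|], so it is nonnegative. *)
  rewrite -/r in quasi_min.
  have := normr_ge0 (r uk); have := normr_ge0 (r uq); rewrite /uq; lra.
move=> v.
have -> : b (uq - uk) v = ipV (r uk - r uq) v.
  have bB : b (uq - uk) v = b uq v - b uk v by rewrite linearBl.
  have rB : ipV (r uk - r uq) v = ipV (r uk) v - ipV (r uq) v.
    by rewrite linearBl.
  by rewrite bB rB !phiE; ring.
apply: le_trans (dot_le_norm _ _ _ ipV_norm _ _) _.
rewrite ler_wpM2r//; apply: le_trans (ler_normB _ _) _.
rewrite -/r in quasi_min; rewrite /uq; lra.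
Qed.
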